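(* Define $f_0,f_1:\Omega\to\Omega$ by $f_0(\alpha)=\alpha$ and $f_1(\alpha)=2$ for all $\alpha$, and let $g=\max\{f_0,f_1\}$ and $h=\min\{f_0,f_1\}$ (pointwise). Define $\Phi$ on $\Omega^{\mathrm{mon}}_{o\to o}$ by $$\Phi(f)=\begin{cases} h, & f\le h,\\ f_{1-i}, & f\le f_i \text{ and } f\not\le h\quad(i\in\{0,1\}),\\ g, &\text{otherwise.}\end{cases}$$ Then $\Phi\in\Omega^{\mathrm{mon}}_{(o\to o)\to(o\to o)}$ (in particular $\Phi$ is monotone), $I_\omega(I_2\Phi)f_0=f_0$ and $I_\omega\Phi f_0=g$. Therefore $I_\omega(I_2\Phi)f_0\ne I_\omega\Phi f_0=I_{2\omega}\Phi f_0$, where $I_\alpha$ denotes $I_\alpha^{o\to o}$ and $2\omega=\omega$ is the ordinal product.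
   Context: $\Omega$ is the first uncountable ordinal. Finite types are generated from a base type $o$ by $\sigma,\tau\mapsto\sigma\to\tau$. The hereditarily monotone type structure: $\Omega^{\mathrm{mon}}_o=\Omega$ with the usual order; $\Omega^{\mathrm{mon}}_{\sigma\to\tau}$ is the set of all monotone functions $\Omega^{\mathrm{mon}}_\sigma\to\Omega^{\mathrm{mon}}_\tau$ ($x\le y$ implies $f(x)\le f(y)$), ordered pointwise. Suprema and infima are computed pointwise. For nonzero countable $\zeta$, $\limsup_{\xi\to\zeta}\{x_\xi\}=\inf_{\gamma<\zeta}\sup_{\gamma\le\xi<\zeta}x_\xi$. For each type $\sigma$ and countable ordinal $\alpha$, the iteration functional $I_\alpha^\sigma$ takes $f\in\Omega^{\mathrm{mon}}_{\sigma\to\sigma}$ and $x\in\Omega^{\mathrm{mon}}_\sigma$ and is defined by (application associates to the left): $I_0^\sigma fx=x$; $I_{\alpha+1}^\sigma fx=f(I_\alpha^\sigma fx)$; $I_\mu^\sigma fx=\limsup_{\xi\to\mu}\{I_\xi^\sigma fx\}$ for limit $\mu$. One has $I_\alpha^\sigma\in\Omega^{\mathrm{mon}}_{(\sigma\to\sigma)\to(\sigma\to\sigma)}$. *)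

(* Defs.v *)
From HB Require Import structures.
From mathcomp Require Import all_boot all_order.
From mathcomp Require Import boolp classical_sets functions cardinality wochoice.
Set Implicit Arguments.
Unset Strict Implicit.
Unset Printing Implicit Defensive.
Import Order.TTheory.
Local Open Scope order_scope.
Local Open Scope classical_set_scope.

(* The first uncountable ordinal is realised as follows: well-order the
   uncountable set of all subsets of nat, and keep the elements that have only
   countably many predecessors. The lemmas Omega_min, Omega_countable_seg and
   Omega_uncountable characterise the result up to a unique isomorphism. *)

Definition wo_rel : rel (set nat) := projT1 (well_ordering_principle (set nat)).

Lemma wo_rel_min (A : set (set nat)) : A !=set0 ->
  exists2 m, A m & forall y, A y -> wo_rel m y.
Proof.
move=> [x Ax]; have [|m [[/asboolP Am mA] _]] :=
  projT2 (well_ordering_principle (set nat)) (fun y => `[< A y >]).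
  by exists x; apply/asboolP.
by exists m => // y Ay; apply: mA; apply/asboolP.
Qed.

Lemma wo_rel_total : total wo_rel.
Proof.
move=> x y; have [|m] := @wo_rel_min [set z | z = x \/ z = y].
  by exists x; left.
by move=> [->|->] h; apply/orP; [left|right]; apply: h; [right|left].
Qed.

Lemma wo_rel_anti : antisymmetric wo_rel.
Proof.
move=> x y /andP[xy yx].
have Rxx z : wo_rel z z by have := wo_rel_total z z; rewrite orbb.
have [|m [_ mu]] :=
  projT2 (well_ordering_principle (set nat)) (fun z => `[< z = x \/ z = y >]).
  by exists x; apply/asboolP; left.
rewrite -[LHS](mu x) -?[RHS](mu y) //; split; try (by apply/asboolP; tauto).
- by move=> z /asboolP[]->.
- by move=> z /asboolP[]->.
Qed.

Lemma wo_rel_trans : transitive wo_rel.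
Proof.
move=> y x z xy yz.
have [|m] := @wo_rel_min [set u | [\/ u = x, u = y | u = z]].
  by exists x; constructor 1.
move=> [] -> h; first by apply: h; constructor 3.
- have yx : wo_rel y x by apply: h; constructor 1.
  by have -> : x = y by apply: wo_rel_anti; rewrite xy yx.
- have zy : wo_rel z y by apply: h; constructor 2.
  by have <- : y = z by apply: wo_rel_anti; rewrite yz zy.
Qed.

Lemma set_nat_uncountable : ~ countable [set: set nat].
Proof.
move/countable_injP => [f /in2TT finj].
pose D : set nat := [set n | exists2 A, f A = n & ~ A n].
have nD : ~ D (f D) by move=> /[dup] DfD [A /finj ->]; apply.
by apply: (nD); exists D.
Qed.

Definition Omega : Type :=
  {x : set nat | countable [set y | wo_rel y x]}.

HB.instance Definition _ := gen_eqMixin Omega.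
HB.instance Definition _ := gen_choiceMixin Omega.

Definition Omega_le (a b : Omega) : bool := wo_rel (sval a) (sval b).

Lemma Omega_le_refl : reflexive Omega_le.
Proof. by move=> a; have := wo_rel_total (sval a) (sval a); rewrite orbb. Qed.

Lemma Omega_le_anti : antisymmetric Omega_le.
Proof. by move=> [x ?] [y ?] /wo_rel_anti xy; apply: eq_exist. Qed.

Lemma Omega_le_trans : transitive Omega_le.
Proof. by move=> b a c; apply: wo_rel_trans. Qed.

Lemma Omega_le_total : total Omega_le.
Proof. by move=> a b; apply: wo_rel_total. Qed.

HB.instance Definition _ := Order.Le_isPOrder.Build (Order.Disp tt tt) Omega
  Omega_le_refl Omega_le_anti Omega_le_trans.
HB.instance Definition _ := Order.POrder_isTotal.Build _ Omega Omega_le_total.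

Lemma Omega_min (A : set Omega) : A !=set0 ->
  exists2 m, A m & forall a, A a -> m <= a.
Proof.
move=> [a Aa]; have [|_ [b Ab <-] h] := @wo_rel_min [set sval b | b in A].
  by exists (sval a); exists a.
by exists b => // c Ac; apply: (h (sval c)); exists c.
Qed.

Lemma Omega_countable_seg (a : Omega) : countable [set b | b <= a].
Proof.
have [f finj] := countable_injP _ (svalP a).
apply/countable_injP; exists (f \o sval) => -[b ?] [c ?].
rewrite !inE => ba ca /finj; rewrite !inE => /(_ ba ca) bc.
exact: eq_exist.
Qed.

Lemma Omega_uncountable : ~ countable [set: Omega].
Proof.
move=> cO.
pose S : set (set nat) := [set x | countable [set y | wo_rel y x]].
have cS : countable S.
  have -> : S = [set sval a | a in [set: Omega]].
    apply/seteqP; split=> [x Sx|_ [a _ <-]]; last exact: svalP.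
    by exists (exist _ x Sx).
  exact: sub_countable (card_image_le _ _) cO.
have [|m nSm mmin] := @wo_rel_min (~` S).
  apply/set0P/eqP => SC0; apply: set_nat_uncountable.
  by rewrite -(setCK S) SC0 setC0 in cS.
apply: nSm; rewrite /S /=.
have [f /in2TT finj] := countable_injP _ cO.
apply/countable_injP.
exists (fun y => if pselect (S y) is left Sy then (f (exist _ y Sy)).+1 else 0%N).
move=> y z; rewrite !inE /= => ym zm.
have eqm u : wo_rel u m -> ~ S u -> u = m.
  by move=> um Su; apply: wo_rel_anti; rewrite um mmin.
case: pselect => [Sy|/(eqm _ ym) ->]; case: pselect => [Sz|/(eqm _ zm) ->] //.
by move=> [/finj [->]].
Qed.

Lemma Omega_wf : well_founded (fun a b : Omega => a < b).
Proof.
move=> a; apply: contrapT => na.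
have [|m nm mmin] := @Omega_min [set b | ~ Acc (fun a b : Omega => a < b) b].
  by exists a.
apply: nm; split=> b bm; apply: contrapT => /mmin.
by rewrite leNgt bm.
Qed.

Lemma Omega_nonempty : [set: Omega] !=set0.
Proof.
by apply/set0P/eqP => O0; apply: Omega_uncountable; rewrite O0.
Qed.

Lemma Omega_ubound (A : set Omega) : countable A ->
  exists b, forall a, A a -> a < b.
Proof.
move=> cA; apply: contrapT => nb; apply: Omega_uncountable.
apply: (@sub_countable _ _ _ (\bigcup_(a in A) [set b | b <= a])).
  apply: subset_card_le => b _; apply: contrapT => nab; apply: nb.
  exists b => a Aa; rewrite ltNge; apply/negP => ba.
  by apply: nab; exists a.
apply: bigcup_countable => // a _; exact: Omega_countable_seg.
Qed.

Definition ozero : Omega := s2val (cid2 (Omega_min Omega_nonempty)).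

Lemma ozero_le (a : Omega) : ozero <= a.
Proof. exact: (s2valP' (cid2 (Omega_min Omega_nonempty))). Qed.

Definition osup (A : set Omega) : Omega := supremum ozero A.
Definition oinf (A : set Omega) : Omega := infimum ozero A.

Lemma osupP (A : set Omega) : countable A -> isLub A (osup A).
Proof.
move=> /Omega_ubound[b Ab].
have [A0|nA0] := eqVneq A set0.
  by rewrite A0 /osup supremum0; split=> // ? _; exact: ozero_le.
rewrite /osup /supremum (negbTE nA0); case: xgetP => [x _ //|nsup].
have [|m Am mA] := @Omega_min (ubound A).
  by exists b => a /Ab/ltW.
by case: (nsup m); split.
Qed.

Lemma oinfP (A : set Omega) : A !=set0 -> A (oinf A) /\ lbound A (oinf A).
Proof.
move=> /[dup] A0 /Omega_min[m Am mA]; rewrite /oinf /infimum.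
move/set0P: A0 => /negbTE ->; case: xgetP => [x _ [Ax xA]|nm].
  split=> //; suff -> : x = m by [].
  by apply/eqP; rewrite eq_le Ax // xA.
by case: (nm m); split=> // b; apply.
Qed.

Definition osucc (a : Omega) : Omega := oinf [set b | a < b].

Lemma osuccP (a : Omega) : a < osucc a /\ forall b, a < b -> osucc a <= b.
Proof.
apply: (oinfP (A := [set b | a < b])).
have [b ab] := Omega_ubound (countable1 a).
by exists b; exact: ab.
Qed.

Lemma osucc_inj : injective osucc.
Proof.
have H c d : osucc c = osucc d -> ~~ (c < d).
  move=> cd; apply/negP => /(proj2 (osuccP c)); rewrite cd leNgt.
  by rewrite (proj1 (osuccP d)).
by move=> a b ab; apply/eqP; rewrite eq_le !leNgt !H.
Qed.

Definition olimit (m : Omega) : Prop :=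
  m <> ozero /\ forall a, m <> osucc a.

Definition onat (n : nat) : Omega := iter n osucc ozero.
Definition oomega : Omega := osup (range onat).

(* Transfinite recursion by cases zero, successor, limit. The sequence handed
   to the limit clause l is padded with z outside the ordinals already treated,
   so l m x should depend on x below m only: see orec_limit. *)
Section Recursion.
Variables (A : Type) (z : A) (s : A -> A) (l : Omega -> (Omega -> A) -> A).

Definition orec_step (a : Omega) (rec : forall b, b < a -> A) : A :=
  if pselect (a = ozero) is left _ then z else
  if pselect (exists b, osucc b = a) is left ex then
    let: exist b ba := cid ex in
    s (rec b (eq_ind (osucc b) (fun c => b < c) (proj1 (osuccP b)) a ba))
  else l a (fun b => if pselect (b < a) is left ba then rec b ba else z).

Definition orec : Omega -> A := Fix Omega_wf (fun=> A) orec_step.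

Lemma orecE a : orec a = orec_step (fun b (_ : b < a) => orec b).
Proof.
rewrite /orec Fix_eq // => {}a f g fg.
by congr orec_step; do 2 apply: functional_extensionality_dep => ?; apply: fg.
Qed.

Lemma orec_zero : orec ozero = z.
Proof. by rewrite orecE /orec_step; case: pselect. Qed.

Lemma orec_succ a : orec (osucc a) = s (orec a).
Proof.
rewrite orecE /orec_step; case: pselect => [sa0|_].
  by have := ozero_le a; rewrite leNgt -sa0 (proj1 (osuccP a)).
case: pselect => [ex|[]]; last by exists a.
by case: cid => b /osucc_inj ->.
Qed.

Lemma orec_limit m : olimit m ->
  (forall x y, (forall a, a < m -> x a = y a) -> l m x = l m y) ->
  orec m = l m orec.
Proof.
move=> [m0 mS] lloc; rewrite orecE /orec_step.
case: pselect => // _; case: pselect => [[b /esym/mS//]|_].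
by apply: lloc => a am; case: pselect.
Qed.

End Recursion.

Definition oadd (a b : Omega) : Omega :=
  orec a osucc (fun m x => osup [set x c | c in [set c | c < m]]) b.
(* omul a b is the ordinal a * b, that is, b consecutive copies of a *)
Definition omul (a b : Omega) : Omega :=
  orec ozero (fun c => oadd c a)
    (fun m x => osup [set x c | c in [set c | c < m]]) b.

Section MonotoneMaps.
Context {d d' : Order.disp_t} {T : porderType d} {T' : porderType d'}.
Implicit Types f g : {omorphism T -> T'}.

Definition mkmono (f : T -> T') (fmono : {homo f : x y / x <= y}) :
    {omorphism T -> T'} :=
  HB.pack f (Order.isOrderMorphism.Build d T d' T' f fmono).

Lemma omorphism_ext f g : f =1 g -> f = g.
Proof.
case: f g => [f [[fm]]] [g [[gm]]] /= /funext fg.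
by subst g; rewrite (Prop_irrelevance fm gm).
Qed.

HB.instance Definition _ := gen_eqMixin {omorphism T -> T'}.
HB.instance Definition _ := gen_choiceMixin {omorphism T -> T'}.

Definition mono_le f g : bool := `[< forall x, f x <= g x >].

Lemma mono_le_refl : reflexive mono_le.
Proof. by move=> f; apply/asboolP. Qed.

Lemma mono_le_anti : antisymmetric mono_le.
Proof.
move=> f g /andP[/asboolP fg /asboolP gf]; apply: omorphism_ext => x.
by apply/eqP; rewrite eq_le fg gf.
Qed.

Lemma mono_le_trans : transitive mono_le.
Proof.
move=> g f h /asboolP fg /asboolP gh; apply/asboolP => x.
exact: le_trans (fg x) (gh x).
Qed.

HB.instance Definition _ := Order.Le_isPOrder.Build d' {omorphism T -> T'}
  mono_le_refl mono_le_anti mono_le_trans.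

Lemma mono_leP f g : reflect (forall x, f x <= g x) (f <= g).
Proof. exact: asboolP. Qed.

End MonotoneMaps.

Inductive ty : Type := o | arrow of ty & ty.
Notation "s ⇒ t" := (arrow s t) (at level 55, right associativity).

Fixpoint Mon (s : ty) : porderType (Order.Disp tt tt) :=
  match s with
  | o => Omega
  | arrow s t => {omorphism Mon s -> Mon t}
  end.

Definition app (s t : ty) (f : Mon (s ⇒ t)) : Mon s -> Mon t :=
  (f : {omorphism Mon s -> Mon t}).
Notation "f ⋅ x" := (app f x) (at level 40, left associativity).

Definition lam (s t : ty) (f : Mon s -> Mon t)
  (fmono : {homo f : x y / x <= y}) : Mon (s ⇒ t) := mkmono fmono.

Section TypeStructure.
Context {s t : ty}.
Implicit Types f g : Mon (s ⇒ t).

Lemma app_mono f : {homo app f : x y / x <= y}.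
Proof. exact: omorph_le. Qed.

Lemma le_app f g : reflect (forall x, f ⋅ x <= g ⋅ x) (f <= g).
Proof. exact: mono_leP. Qed.

Lemma app_ext f g : (forall x, f ⋅ x = g ⋅ x) -> f = g.
Proof. exact: omorphism_ext. Qed.

End TypeStructure.

Definition mono_op (s : ty) (F : (Omega -> Mon s) -> Mon s) : Prop :=
  forall x y, (forall a, x a <= y a) -> F x <= F y.

Lemma pointwise_subproof1 (s t : ty) (F : (Omega -> Mon t) -> Mon t)
  (F_mono : mono_op F) (x : Omega -> Mon (s ⇒ t)) :
  {homo (fun u => F (fun a => x a ⋅ u)) : u v / u <= v}.
Proof. by move=> u v uv; apply: F_mono => a; apply: app_mono. Qed.

Lemma pointwise_subproof2 (s t : ty) (F : (Omega -> Mon t) -> Mon t)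
  (F_mono : mono_op F) :
  mono_op (fun x : Omega -> Mon (s ⇒ t) => lam (pointwise_subproof1 F_mono x)).
Proof. by move=> x y xy; apply/le_app => u; apply: F_mono => a; apply/le_app. Qed.

Fixpoint pointwise_sig (F : (Omega -> Mon o) -> Mon o) (F_mono : mono_op F)
    (s : ty) : {G : (Omega -> Mon s) -> Mon s | mono_op G} :=
  match s with
  | o => exist _ F F_mono
  | arrow s t =>
      let: exist G G_mono := pointwise_sig F_mono t in
      exist _ (fun x : Omega -> Mon (s ⇒ t) => lam (pointwise_subproof1 G_mono x))
        (@pointwise_subproof2 s t G G_mono)
  end.

(* The pointwise extension to all types of an operation F on families of
   ordinals; the equations are pointwise_o and pointwise_app. *)
Definition pointwise (F : (Omega -> Mon o) -> Mon o) (F_mono : mono_op F)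
  (s : ty) : (Omega -> Mon s) -> Mon s := sval (pointwise_sig F_mono s).

Section Pointwise.
Variables (F : (Omega -> Mon o) -> Mon o) (F_mono : mono_op F).

Lemma pointwise_o (x : Omega -> Mon o) : pointwise F_mono x = F x.
Proof. by []. Qed.

Lemma pointwise_app (s t : ty) (x : Omega -> Mon (s ⇒ t)) (u : Mon s) :
  pointwise F_mono x ⋅ u = pointwise F_mono (fun a => x a ⋅ u).
Proof. by rewrite /pointwise /=; case: (pointwise_sig F_mono t). Qed.

Lemma pointwise_mono (s : ty) : mono_op (@pointwise F F_mono s).
Proof. exact: (svalP (pointwise_sig F_mono s)). Qed.

Lemma pointwise_local (z : Omega) (s : ty) (x y : Omega -> Mon s) :
  (forall x y, (forall a, a < z -> x a = y a) -> F x = F y) ->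
  (forall a, a < z -> x a = y a) -> pointwise F_mono x = pointwise F_mono y.
Proof.
move=> Floc; elim: s x y => [|s _ t IHt] x y xy; first exact: Floc.
by apply: app_ext => u; rewrite !pointwise_app; apply: IHt => a /xy ->.
Qed.

End Pointwise.

Definition sup_o (c z : Omega) (x : Omega -> Mon o) : Mon o :=
  osup [set x a | a in [set a | c <= a < z]].
Definition inf_o (z : Omega) (x : Omega -> Mon o) : Mon o :=
  oinf [set x c | c in [set c | c < z]].

Lemma sup_oP (c z : Omega) (x : Omega -> Mon o) :
  isLub [set x a | a in [set a | c <= a < z]] (sup_o c z x).
Proof.
apply: osupP; apply: sub_countable (card_image_le _ _) _.
apply: sub_countable (Omega_countable_seg z).
by apply: subset_card_le => a /andP[_ /ltW].
Qed.

Lemma sup_o_mono (c z : Omega) : mono_op (sup_o c z).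
Proof.
move=> x y xy; have [_] := sup_oP c z x; apply=> _ [a az <-].
apply: le_trans (xy a) _; have [ub _] := sup_oP c z y.
by apply: ub; exists a.
Qed.

Lemma inf_o_mono (z : Omega) : mono_op (inf_o z).
Proof.
move=> x y xy; rewrite /inf_o.
have [z0|nz0] := eqVneq [set c : Omega | c < z] set0.
  by rewrite z0 !image_set0.
have ne (w : Omega -> Omega) : [set w c | c in [set c | c < z]] !=set0.
  by have /set0P[c cz] := nz0; exists (w c); exists c.
have [[c cz yc] _] := oinfP (ne y); rewrite -yc.
have [_ lb] := oinfP (ne x).
by apply: le_trans (xy c); apply: lb; exists c.
Qed.

Definition msup (s : ty) (c z : Omega) (x : Omega -> Mon s) : Mon s :=
  pointwise (@sup_o_mono c z) x.
Definition minf (s : ty) (z : Omega) (x : Omega -> Mon s) : Mon s :=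
  pointwise (@inf_o_mono z) x.

Lemma msup_lub (s : ty) (c z : Omega) (x : Omega -> Mon s) :
  isLub [set x a | a in [set a | c <= a < z]] (msup c z x).
Proof.
elim: s x => [|s _ t IHt] x; first exact: sup_oP.
split=> [_ [a az <-]|f ub]; apply/le_app => u; rewrite pointwise_app.
  by have [ub _] := IHt (fun a => x a ⋅ u); apply: ub; exists a.
have [_] := IHt (fun a => x a ⋅ u); apply=> _ [a az <-].
by have /le_app := ub (x a) (ex_intro2 _ _ a az erefl).
Qed.

Lemma minf_glb (s : ty) (z : Omega) (x : Omega -> Mon s) : z <> ozero ->
  infimums [set x c | c in [set c | c < z]] (minf z x).
Proof.
move=> z0; elim: s x => [|s _ t IHt] x.
  have /oinfP[inA lb] : [set x c | c in [set c : Omega | c < z]] !=set0.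
    exists (x ozero); exists ozero => //=.
    by rewrite lt_neqAle ozero_le andbT; apply/eqP => /esym.
  by split=> // b; apply.
split=> [_ [c cz <-]|f lb]; apply/le_app => u; rewrite pointwise_app.
  by have [lb _] := IHt (fun c => x c ⋅ u); apply: lb; exists c.
have [_] := IHt (fun c => x c ⋅ u); apply=> _ [c cz <-].
by have /le_app := lb (x c) (ex_intro2 _ _ c cz erefl).
Qed.

Definition mlimsup (s : ty) (z : Omega) (x : Omega -> Mon s) : Mon s :=
  minf z (fun c => msup c z x).

Lemma mlimsup_mono (s : ty) (z : Omega) : mono_op (@mlimsup s z).
Proof. by move=> x y xy; do 2 apply: pointwise_mono => ?. Qed.

Lemma mlimsup_local (s : ty) (z : Omega) (x y : Omega -> Mon s) :
  (forall a, a < z -> x a = y a) -> mlimsup z x = mlimsup z y.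
Proof.
move=> xy; congr minf; apply: funext => c.
apply: (@pointwise_local _ _ z) => // v w vw; congr osup.
by apply: eq_imagel => a /andP[_ /vw].
Qed.

Definition iterate (s : ty) (f : Mon (s ⇒ s)) (x : Mon s) (a : Omega) : Mon s :=
  orec x (app f) (@mlimsup s) a.

Lemma iterate_mono (s : ty) (f g : Mon (s ⇒ s)) (x y : Mon s) (a : Omega) :
  f <= g -> x <= y -> iterate f x a <= iterate g y a.
Proof.
move=> fg xy; elim/(well_founded_ind Omega_wf): a => a IH.
rewrite /iterate !orecE /orec_step; case: pselect => // _.
case: pselect => [ex|_]; last first.
  by apply: mlimsup_mono => b; case: pselect => // ba; apply: IH.
case: cid => b ba /=.
apply: (@le_trans _ _ (f ⋅ iterate g y b)); last exact/le_app.
by apply: app_mono; apply: IH; rewrite -ba; exact: (proj1 (osuccP b)).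
Qed.

Lemma It_subproof1 (s : ty) (a : Omega) (f : Mon (s ⇒ s)) :
  {homo (fun x => iterate f x a) : x y / x <= y}.
Proof. by move=> x y; apply: iterate_mono. Qed.

Lemma It_subproof2 (s : ty) (a : Omega) :
  {homo (fun f : Mon (s ⇒ s) => lam (It_subproof1 a f)) : f g / f <= g}.
Proof. by move=> f g fg; apply/le_app => x; apply: iterate_mono. Qed.

Definition It (s : ty) (a : Omega) : Mon ((s ⇒ s) ⇒ (s ⇒ s)) :=
  lam (@It_subproof2 s a).

Section IterationEquations.
Variables (s : ty) (f : Mon (s ⇒ s)) (x : Mon s).

Lemma It_zero : It s ozero ⋅ f ⋅ x = x.
Proof. exact: orec_zero. Qed.

Lemma It_succ a : It s (osucc a) ⋅ f ⋅ x = f ⋅ (It s a ⋅ f ⋅ x).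
Proof. exact: orec_succ. Qed.

Lemma It_limit m : olimit m ->
  It s m ⋅ f ⋅ x = mlimsup m (fun a => It s a ⋅ f ⋅ x).
Proof. by move=> ml; apply: orec_limit => // v w; apply: mlimsup_local. Qed.

End IterationEquations.

Lemma fid_mono : {homo (fun a : Mon o => a) : a b / a <= b}.
Proof. by []. Qed.
Definition f0 : Mon (o ⇒ o) := lam fid_mono.

Lemma fconst_mono : {homo (fun _ : Mon o => onat 2 : Mon o) : a b / a <= b}.
Proof. by []. Qed.
Definition f1 : Mon (o ⇒ o) := lam fconst_mono.

Lemma max_mono (f g : Mon (o ⇒ o)) :
  {homo (fun a => Order.max (f ⋅ a : Omega) (g ⋅ a) : Mon o) : a b / a <= b}.
Proof.
by move=> a b ab; rewrite ge_max !le_max !(@app_mono o o _ a b ab) orbT.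
Qed.
Definition g : Mon (o ⇒ o) := lam (@max_mono f0 f1).

Lemma min_mono (f g : Mon (o ⇒ o)) :
  {homo (fun a => Order.min (f ⋅ a : Omega) (g ⋅ a) : Mon o) : a b / a <= b}.
Proof.
by move=> a b ab; rewrite le_min !ge_min !(@app_mono o o _ a b ab) orbT.
Qed.
Definition h : Mon (o ⇒ o) := lam (@min_mono f0 f1).

(* The two middle cases exclude each other: f <= f0 and f <= f1 give f <= h. *)
Definition Phi (f : Mon (o ⇒ o)) : Mon (o ⇒ o) :=
  if f <= h then h
  else if f <= f0 then f1
  else if f <= f1 then f0
  else g.

(* Main.v *)
Require Import Defs.
From mathcomp Require Import all_boot all_order.
From mathcomp Require Import boolp classical_sets cardinality.
Set Implicit Arguments.
Unset Strict Implicit.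
Unset Printing Implicit Defensive.
Import Order.TTheory.
Local Open Scope classical_set_scope.
Local Open Scope order_scope.

(** The map [Phi] exchanges [f0] and [f1], so its finite iterates at [f0]
    alternate between these two incomparable functions and every tail of the
    sequence has supremum [g]. The iterates of [I_2 Phi] at [f0] see only every
    second term and stay at [f0]. *)

Lemma isLub_unique d (T : porderType d) (A : set T) (x y : T) :
  isLub A x -> isLub A y -> x = y.
Proof. by move=> [ux lx] [uy ly]; apply/le_anti; rewrite lx // ly. Qed.

Lemma isLub_osup (A : set Omega) (a : Omega) :
  countable A -> isLub A a -> osup A = a.
Proof. by move=> /osupP; apply: isLub_unique. Qed.

Lemma lt_osuccE (a b : Omega) : (a < osucc b) = (a <= b).
Proof.
have [bS Sle] := osuccP b.
apply/idP/idP => [aS|/le_lt_trans]; last exact.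
by rewrite leNgt; apply/negP => /Sle; rewrite leNgt aS.
Qed.

Lemma onat_homo (m n : nat) : (m <= n)%N -> onat m <= onat n.
Proof.
elim: n => [|n IHn]; first by rewrite leqn0 => /eqP ->.
rewrite leq_eqVlt => /predU1P[->//|/IHn mn].
by apply: ltW; rewrite [onat n.+1]/= lt_osuccE.
Qed.

Lemma lt_onatP (a : Omega) (n : nat) : a < onat n -> exists m, a = onat m.
Proof.
elim: n => [|n IHn]; first by rewrite ltNge ozero_le.
rewrite [onat n.+1]/= lt_osuccE le_eqVlt => /predU1P[->|/IHn//].
by exists n.
Qed.

Lemma oomega_lub : isLub (range onat) oomega.
Proof. by apply: osupP; apply: sub_countable (card_image_le _ _) _. Qed.

Lemma onat_lt_omega (n : nat) : onat n < oomega.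
Proof.
have [ub _] := oomega_lub.
apply: lt_le_trans (proj1 (osuccP (onat n))) _.
by apply: ub; exists n.+1.
Qed.

(** By [lt_onatP] the finite ordinals form an initial segment, so an [a] outside it bounds them all,
    and then the least upper bound [oomega] is at most [a]. *)
Lemma lt_omegaP (a : Omega) : a < oomega -> exists n, a = onat n.
Proof.
move=> aw; apply: contrapT => na; move: aw; rewrite ltNge => /negP; apply.
have [_] := oomega_lub; apply=> _ [n _ <-].
by rewrite leNgt; apply/negP => /lt_onatP.
Qed.

Lemma oomega_limit : olimit oomega.
Proof.
split=> [w0|a wa]; first by have := onat_lt_omega 0; rewrite w0 ltxx.
have [n an] : exists n, a = onat n.
  by apply: lt_omegaP; rewrite wa lt_osuccE.
by have := onat_lt_omega n.+1; rewrite wa an ltxx.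
Qed.

(** This is the locality that [orec_limit] asks of the limit clause of [omul]. *)
Lemma osup_local (m : Omega) (x y : Omega -> Omega) :
  (forall a, a < m -> x a = y a) ->
  osup [set x c | c in [set c | c < m]] = osup [set y c | c in [set c | c < m]].
Proof. by move=> xy; congr osup; apply: eq_imagel => a /xy. Qed.

Lemma omul2_onat (n : nat) : omul (onat 2) (onat n) = onat n.*2.
Proof.
rewrite /omul; elim: n => [|n IHn]; first exact: orec_zero.
by rewrite [onat n.+1]/= orec_succ IHn /oadd !orec_succ orec_zero.
Qed.

Lemma omul2_omega : omul (onat 2) oomega = oomega.
Proof.
rewrite {1}/omul (orec_limit _ _ oomega_limit); last exact: osup_local.
apply: isLub_osup.
  apply: sub_countable (card_image_le _ _) _.
  apply: sub_countable (Omega_countable_seg oomega).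
  by apply: subset_card_le => a /ltW.
split=> [_ [c /lt_omegaP[n ->] <-]|b ub].
  by have := omul2_onat n; rewrite /omul => ->; exact: ltW (onat_lt_omega _).
have [_] := oomega_lub; apply=> _ [n _ <-].
(* The values [onat n.*2] are cofinal among the finite ordinals, since [n] is at most [n.*2]. *)
apply: (@le_trans _ _ (onat n.*2)).
  by apply: onat_homo; rewrite -addnn leq_addr.
by apply: ub; exists (onat n); [exact: onat_lt_omega|exact: omul2_onat].
Qed.

(** The infimum is taken over a constant family, which is nonempty because [z] is not [ozero]. *)
Lemma mlimsup_tail_lub (s : ty) (z : Omega) (x : Omega -> Mon s) (y : Mon s) :
  z <> ozero ->
  (forall c, c < z -> isLub [set x a | a in [set a | c <= a < z]] y) ->
  mlimsup z x = y.
Proof.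
move=> z0 ylub.
have supE c : c < z -> msup c z x = y.
  by move=> /ylub; apply: isLub_unique; exact: msup_lub.
have [lb glb] := minf_glb (fun c => msup c z x) z0.
apply/le_anti/andP; split; last first.
  by apply: glb => _ [c cz <-]; rewrite supE.
have z_gt0 : ozero < z.
  by rewrite lt_neqAle ozero_le andbT; apply/eqP => /esym.
by rewrite -(supE _ z_gt0); apply: lb; exists ozero.
Qed.

Lemma It_onat (s : ty) (f : Mon (s ⇒ s)) (x : Mon s) (n : nat) :
  It s (onat n) ⋅ f ⋅ x = iter n (app f) x.
Proof. by elim: n => [|n IHn]; rewrite (It_zero, It_succ) ?IHn. Qed.

Lemma It_omega_fix (s : ty) (f : Mon (s ⇒ s)) (x : Mon s) :
  f ⋅ x = x -> It s oomega ⋅ f ⋅ x = x.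
Proof.
move=> fx; rewrite (It_limit _ _ oomega_limit).
apply: mlimsup_tail_lub => [|c cw]; first by have [] := oomega_limit.
have Ifx a : a < oomega -> It s a ⋅ f ⋅ x = x.
  by move=> /lt_omegaP[n ->]; rewrite It_onat; elim: n => //= n ->.
split=> [_ [a /andP[_ aw] <-]|b]; first by rewrite Ifx.
(* The index [c] lies in its own tail, so every upper bound of the tail is above [x]. *)
by apply; exists c; rewrite ?Ifx //= lexx.
Qed.

(** The finite iterates alternate between [x] and [y], so every tail takes exactly these two
    values. *)
Lemma It_omega_swap (s : ty) (f : Mon (s ⇒ s)) (x y z : Mon s) :
  f ⋅ x = y -> f ⋅ y = x -> isLub [set x; y] z -> It s oomega ⋅ f ⋅ x = z.
Proof.
move=> fx fy [zub zlb]; rewrite (It_limit _ _ oomega_limit).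
have Ifx n : It s (onat n) ⋅ f ⋅ x = if odd n then y else x.
  by rewrite It_onat; elim: n => //= n ->; case: odd.
apply: mlimsup_tail_lub => [|c /lt_omegaP[n ->{c}]].
  by have [] := oomega_limit.
split=> [_ [a /andP[_ /lt_omegaP[m ->]] <-]|b ub].
  by rewrite Ifx; apply: zub; case: odd; [right|left].
have ubI m : (n <= m)%N -> (if odd m then y else x) <= b.
  move=> nm; rewrite -Ifx; apply: ub; exists (onat m) => //=.
  by rewrite onat_homo // onat_lt_omega.
(* The indices [n] and [n.+1] have opposite parity, so together they show both values. *)
have := ubI n (leqnn n); have := ubI n.+1 (leqnSn n); rewrite /=.
by case: odd => /= h1 h2; apply: zlb => _ [] ->.
Qed.

(** Since [h] is the meet of [f0] and [f1], all tests in [Phi] reduce to the two comparisons with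
    [f0] and [f1]. *)
Lemma le_hE (f : Mon (o ⇒ o)) : (f <= h) = (f <= f0) && (f <= f1).
Proof.
apply/idP/andP => [/le_app fh|[/le_app ff0 /le_app ff1]].
  by split; apply/le_app => x; have := fh x; rewrite le_min => /andP[].
by apply/le_app => x; rewrite le_min; apply/andP; split; [exact: ff0|exact: ff1].
Qed.

Lemma g_leE (f : Mon (o ⇒ o)) : (g <= f) = (f0 <= f) && (f1 <= f).
Proof.
apply/idP/andP => [/le_app fh|[/le_app ff0 /le_app ff1]].
  by split; apply/le_app => x; have := fh x; rewrite ge_max => /andP[].
by apply/le_app => x; rewrite ge_max; apply/andP; split; [exact: ff0|exact: ff1].
Qed.

Lemma f0_nle_f1 : (f0 <= f1) = false.
Proof.
(* At 3 the identity exceeds the constant 2; at 0, used for the converse below, it is smaller. *)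
apply/negP => /le_app/(_ (onat 3)); apply/negP.
by rewrite -ltNge; exact: (proj1 (osuccP (onat 2))).
Qed.

Lemma f1_nle_f0 : (f1 <= f0) = false.
Proof.
apply/negP => /le_app/(_ ozero); apply/negP.
rewrite -ltNge; apply: le_lt_trans (ozero_le (onat 1)) _.
exact: (proj1 (osuccP (onat 1))).
Qed.

Lemma Phi_f0 : Phi f0 = f1.
Proof. by rewrite /Phi le_hE f0_nle_f1 andbF lexx. Qed.

Lemma Phi_f1 : Phi f1 = f0.
Proof. by rewrite /Phi le_hE f1_nle_f0 lexx. Qed.

Lemma g_lub : isLub [set f0; f1] g.
Proof.
have := lexx g; rewrite g_leE => /andP[f0g f1g].
split=> [_ [] -> //|b ub].
by rewrite g_leE; apply/andP; split; apply: ub; [left|right].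
Qed.

(** Enlarging the argument can only make the tests against [f0] and [f1] fail. With both passed the
    value is the bottom [h], with none the top [g]; if [f'] passes exactly one, then [f] passes it
    too and is sent to the same value or to [h]. *)
Lemma Phi_monotone : {homo Phi : f f' / f <= f'}.
Proof.
have := lexx g; rewrite g_leE => /andP[f0g f1g].
have := lexx h; rewrite le_hE => /andP[hf0 hf1].
have hg : h <= g := le_trans hf0 f0g.
move=> f f' ff'; rewrite /Phi !le_hE.
have mono k : f' <= k -> f <= k by exact: le_trans.
have := mono f0; have := mono f1.
(* The cases where [f'] passes a test that [f] fails contradict [mono]. *)
by case: (f' <= f0); case: (f' <= f1); case: (f <= f0); case: (f <= f1) => //=;
   move=> m1 m0; try discriminate (m0 erefl); try discriminate (m1 erefl).
Qed.

Theorem mainTheorem3 :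
  exists Phi_mono : {homo Phi : f f' / f <= f'},
  let P : Mon ((o ⇒ o) ⇒ (o ⇒ o)) := lam Phi_mono in
  let I (a : Omega) := It (o ⇒ o) a in
  [/\ I oomega ⋅ (I (onat 2) ⋅ P) ⋅ f0 = f0,
      I oomega ⋅ P ⋅ f0 = g,
      I oomega ⋅ (I (onat 2) ⋅ P) ⋅ f0 <> I oomega ⋅ P ⋅ f0,
      I oomega ⋅ P ⋅ f0 = I (omul (onat 2) oomega) ⋅ P ⋅ f0
    & omul (onat 2) oomega = oomega].
Proof.
exists Phi_monotone => P I.
have Iw2 : I oomega ⋅ (I (onat 2) ⋅ P) ⋅ f0 = f0.
  (* Two swaps bring [f0] back, so it is a fixed point of the second iterate of [Phi]. *)
  apply: It_omega_fix; rewrite It_onat.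
  by apply: etrans Phi_f1; congr Phi; exact: Phi_f0.
have Iw : I oomega ⋅ P ⋅ f0 = g :=
    It_omega_swap (f := P) Phi_f0 Phi_f1 g_lub.
(* Only the inequality is left: [f0 = g] would put [f1] below [f0]. *)
split; rewrite ?omul2_omega // Iw2 Iw => f0g; have := lexx g.
by rewrite g_leE -f0g f1_nle_f0 andbF.
Qed.
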